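(* Let $q\ge 2$ and $n\ge 1$ be integers, and let $S=(s_i)$ be a negative orientable sequence of order $n$ over $\mathbb{Z}_q$ with period $m$. Let $h$ be the additive order of $w_q(S)$ in $\mathbb{Z}_q$. Then there are $q/h$ sequences $T_1,\dots,T_{q/h}$, each an orientable sequence of order $n+1$ with period $hm$, which are translates of one another and pairwise o-disjoint, such that $D^{-1}(S)$ consists exactly of the $h$ shifts $(t_{i+km})_i$, $0\le k\le h-1$, of each $T_\ell=(t_i)$.
   Context: Sequences are periodic with entries in $\mathbb{Z}_q$; the period means the least period. For $S=(s_i)$ of period $m$, $\mathbf{s}_n(i)=(s_i,\dots,s_{i+n-1})$; the ring sequence is $[s_0,\dots,s_{m-1}]$ and $w_q(S)=\sum_{i=0}^{m-1}s_i \bmod q$. For a tuple $\mathbf{u}=(u_0,\dots,u_{n-1})$, $\mathbf{u}^R=(u_{n-1},\dots,u_0)$ and $-\mathbf{u}=(-u_0,\dots,-u_{n-1})$. $S$ is an $n$-window sequence if $\mathbf{s}_n(i)=\mathbf{s}_n(j)$ implies $i\equiv j\pmod m$. An orientable sequence of order $n$ is an $n$-window sequence with $\mathbf{s}_n(i)\neq\mathbf{s}_n(j)^R$ for all $i,j$; a negative orientable sequence of order $n$ is an $n$-window sequence with $\mathbf{s}_n(i)\neq-\mathbf{s}_n(j)^R$ for all $i,j$. Two $n$-window sequences $S,S'$ are disjoint if $\mathbf{s}_n(i)\neq\mathbf{s}'_n(j)$ for all $i,j$, and o-disjoint if they are disjoint and $\mathbf{s}_n(i)\neq\mathbf{s}'_n(j)^R$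 for all $i,j$. A translate of $(t_i)$ is $(t_i+\lambda)$ for nonzero $\lambda\in\mathbb{Z}_q$; a shift is $(t_{i+k})$. $D$ maps $(t_i)$ to $(t_{i+1}-t_i)$, and $D^{-1}(S)$ is the set of all periodic sequences $T$ with $D(T)=S$. *)

(* Defs.v *)
From mathcomp Require Import all_boot all_order all_algebra all_fingroup.

Set Implicit Arguments.
Unset Strict Implicit.
Unset Printing Implicit Defensive.

Import GRing.Theory.

(* A sequence (s_i) is indexed by i : nat. Periodicity holds from index 0 on
   (no preperiod), so this is the same as indexing a periodic sequence by the
   integers. Sequences are compared pointwise, with =1. 'Z_q has the intended
   meaning only for 1 < q. *)

Section Sequences.

Variable q : nat.
Implicit Types (s t : nat -> 'Z_q) (m n p i j k : nat) (u : seq 'Z_q).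

Definition repeats_every s p := 0 < p /\ forall i, s (i + p) = s i.

Definition periodic s := exists p, repeats_every s p.

Definition has_period s m :=
  repeats_every s m /\ forall p, repeats_every s p -> m <= p.

Definition window n s i : seq 'Z_q := mkseq (fun k => s (i + k)) n.

Definition negate u : seq 'Z_q := [seq (- x)%R | x <- u].

Definition weight m s : 'Z_q := (\sum_(i < m) s i)%R.

(* The predicates below take the period m of s as a parameter and include the
   assertion that m is the least period of s. *)
Definition window_sequence n m s :=
  has_period s m /\
  forall i j, window n s i = window n s j -> i = j %[mod m].

Definition orientable n m s :=
  window_sequence n m s /\
  forall i j, window n s i <> rev (window n s j).

Definition negative_orientable n m s :=
  window_sequence n m s /\
  forall i j, window n s i <> negate (rev (window n s j)).

Definition disjoint_seq n s t :=
  forall i j, window n s i <> window n t j.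

Definition o_disjoint n s t :=
  disjoint_seq n s t /\
  forall i j, window n s i <> rev (window n t j).

Definition is_translate s t :=
  exists2 a : 'Z_q, a != 0%R & t =1 (fun i => (s i + a)%R).

Definition shift k s : nat -> 'Z_q := fun i => s (i + k).

Definition D s : nat -> 'Z_q := fun i => (s i.+1 - s i)%R.

Definition in_Dinv s t := periodic t /\ D t =1 s.

(* The finGroupType structure of 'Z_q is the additive one. *)
Definition additive_order (a : 'Z_q) : nat := #[a]%g.

End Sequences.

(* Main.v *)
Require Import Defs.
From mathcomp Require Import all_boot all_order all_algebra all_fingroup.
From mathcomp Require Import cyclic.

(* Up to an additive constant c, the only sequence T with D T = S is the
   sequence of partial sums t_i = s_0 + ... + s_(i-1), and t_(i+m) = t_i + w
   with w the weight of S, so adding a multiple of w amounts to shifting by a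
   multiple of m.  Reducing c modulo the subgroup generated by w leaves q/h
   choices, represented by 0, ..., q/h - 1.  A coincidence between windows of
   length n+1 of preimages descends, by taking differences, to a coincidence
   between windows of length n of S; reversing a window of T reverses and
   negates the window of differences, which is excluded for S. *)

Set Implicit Arguments.
Unset Strict Implicit.
Unset Printing Implicit Defensive.

Import GRing.Theory.
Local Open Scope ring_scope.

Section Windows.

Variable q : nat.
Implicit Types (s t : nat -> 'Z_q) (n i j k : nat).

Lemma eq_windowP n s t i j :
  window n s i = window n t j <->
  forall k, (k < n)%N -> s (i + k)%N = t (j + k)%N.
Proof.
split=> [eq_st k lt_kn | eq_st].
  by have := congr1 (nth 0 ^~ k) eq_st; rewrite !nth_mkseq.
apply: (@eq_from_nth _ 0) => [|k]; rewrite !size_mkseq // => lt_kn.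
by rewrite !nth_mkseq // eq_st.
Qed.

Lemma nth_rev_window n t j k : (k < n)%N ->
  nth 0 (rev (window n t j)) k = t (j + (n - k.+1))%N.
Proof.
move=> lt_kn; rewrite nth_rev ?size_mkseq // nth_mkseq //.
by rewrite ltn_subrL (leq_ltn_trans _ lt_kn).
Qed.

Lemma window_D n t t' i j :
  window n.+1 t i = window n.+1 t' j -> window n (D t) i = window n (D t') j.
Proof.
move/eq_windowP=> eq_tt'; apply/eq_windowP => k lt_kn.
by rewrite /D -!addnS !eq_tt' // ltnW.
Qed.

Lemma rev_window_D n t t' i j :
  window n.+1 t i = rev (window n.+1 t' j) ->
  window n (D t) i = negate (rev (window n (D t') j)).
Proof.
move=> eq_tt'.
(* The reversed window is read from its last index [j + n] downwards, so a forward step on the left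
   is a backward step on the right; this is where the sign comes from. *)
have tE k : (k < n.+1)%N -> t (i + k)%N = t' (j + (n - k))%N.
  move=> lt_kn; have := congr1 (nth 0 ^~ k) eq_tt'.
  by rewrite /= nth_rev_window // nth_mkseq.
apply: (@eq_from_nth _ 0) => [|k].
  by rewrite size_mkseq size_map size_rev size_mkseq.
rewrite size_mkseq => lt_kn; rewrite nth_mkseq //.
rewrite /negate (nth_map 0) ?size_rev ?size_mkseq // nth_rev_window // /D.
by rewrite -!addnS !tE // 1?ltnW // opprB subnSK.
Qed.

Lemma eq_window n s t i : s =1 t -> window n s i = window n t i.
Proof. by move=> eq_st; apply/eq_windowP => k _; apply: eq_st. Qed.

End Windows.

Section CosetRepresentatives.

Variables (q : nat) (a : 'Z_q).
Hypothesis q_gt1 : (1 < q)%N.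
Let h := additive_order a.

Lemma additive_order_gt0 : (0 < h)%N.
Proof. exact: order_gt0. Qed.

Lemma additive_order_dvd : (h %| q)%N.
Proof.
have := order_dvdG (in_setT a).
by rewrite cardsT card_ord Zp_cast.
Qed.

(** Multiples in ['Z_q] are powers in its additive [finGroupType] structure, where exponents count
    modulo the order. *)
Lemma eq_mulrn_mod_order k k' : (a *+ k == a *+ k') = (k == k' %[mod h]).
Proof. by rewrite -!FinRing.zmodXgE eq_expg_mod_order. Qed.

Lemma mulrn_additive_order : a *+ h = 0.
Proof. by apply/eqP; rewrite -(mulr0n a) eq_mulrn_mod_order modnn mod0n. Qed.

Lemma eq_Zp_nat_small l l' : (l < q)%N -> (l' < q)%N ->
  l%:R = l'%:R :> 'Z_q -> l = l'.
Proof.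
by move=> ltl ltl' /(congr1 val) /=; rewrite !val_Zp_nat // !modn_small.
Qed.

(* Multiplying by h kills the multiples of a and leaves l * h, l' * h < q. *)
Lemma coset_repr_inj l l' k k' : (l < q %/ h)%N -> (l' < q %/ h)%N ->
  l%:R + a *+ k = l'%:R + a *+ k' -> l = l' /\ k = k' %[mod h].
Proof.
move=> ltl ltl' eq_lk.
have lt_mul p : (p < q %/ h)%N -> (p * h < q)%N.
  by move=> ltp; rewrite -ltn_divRL // additive_order_dvd.
have := congr1 (fun x : 'Z_q => x *+ h) eq_lk.
rewrite /= !mulrnDl ![a *+ _ *+ h]mulrnAC mulrn_additive_order !mul0rn !addr0.
rewrite -!mulrnA.
move/(eq_Zp_nat_small (lt_mul _ ltl) (lt_mul _ ltl'))/eqP.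
rewrite eqn_pmul2r ?additive_order_gt0 // => /eqP eq_l; split=> //.
by move: eq_lk; rewrite eq_l => /addrI/eqP; rewrite eq_mulrn_mod_order => /eqP.
Qed.

(** By counting: the pairs [(l, k)] number [(q %/ h) * h = q], so the injective map sending them to
    [l%:R + a *+ k] is onto ['Z_q]. *)
Lemma coset_repr_surj (c : 'Z_q) :
  exists l : 'I_(q %/ h), exists2 k, (k < h)%N & c = l%:R + a *+ k.
Proof.
pose f (x : 'I_(q %/ h) * 'I_h) : 'Z_q := x.1%:R + a *+ x.2.
have f_inj : injective f.
  move=> [l k] [l' k'] /(coset_repr_inj (ltn_ord l) (ltn_ord l')) [/= eq_l eq_k].
  congr pair; apply: val_inj => //=.
  by rewrite -(modn_small (ltn_ord k)) eq_k modn_small.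
have /codomP[[l k] ->] : c \in codom f.
  apply: (inj_card_onto f_inj).
  by rewrite card_prod !card_ord Zp_cast // divnK ?additive_order_dvd.
by exists l, k.
Qed.

End CosetRepresentatives.

Section PartialSums.

Variables (q m : nat) (s : nat -> 'Z_q).
Hypothesis s_period : forall i, s (i + m)%N = s i.

Definition partial_sum i : 'Z_q := \sum_(j < i) s j.

Lemma partial_sumS i : partial_sum i.+1 = partial_sum i + s i.
Proof. by rewrite /partial_sum big_ord_recr. Qed.

Lemma partial_sum_add_period i : partial_sum (i + m) = partial_sum i + weight m s.
Proof.
(* At [i = 0] both sides are the sum of [s] over one period. *)
elim: i => [|i IHi]; first by rewrite /partial_sum big_ord0 add0r.
by rewrite addSn !partial_sumS IHi s_period addrAC.
Qed.

Lemma partial_sum_addM_period i k :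
  partial_sum (i + k * m) = partial_sum i + weight m s *+ k.
Proof.
elim: k => [|k IHk]; first by rewrite addn0 addr0.
by rewrite mulSnr addnA partial_sum_add_period IHk mulrSr addrA.
Qed.

Lemma D_partial_sum c : D (fun i => partial_sum i + c) =1 s.
Proof. by move=> i; rewrite /D /= partial_sumS [_ + s i]addrC -[_ + c]addrA addrK. Qed.

Lemma eq_partial_sum_of_D t : D t =1 s -> forall i, t i = partial_sum i + t 0%N.
Proof.
move=> Dt; elim=> [|i IHi]; first by rewrite /partial_sum big_ord0 add0r.
by rewrite partial_sumS addrAC -IHi -Dt addrC subrK.
Qed.

End PartialSums.

Local Close Scope ring_scope.

Theorem theorem6 (q n m : nat) (hq : 1 < q) (hn : 0 < n)
    (S : nat -> 'Z_q) (hS : negative_orientable n m S) :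
  let h := additive_order (weight m S) in
  exists T : 'I_(q %/ h) -> nat -> 'Z_q,
    [/\ forall l, orientable n.+1 (h * m) (T l),
        forall l l', l != l' -> is_translate (T l) (T l'),
        forall l l', l != l' -> o_disjoint n.+1 (T l) (T l')
      & forall U : nat -> 'Z_q,
          in_Dinv S U <->
          exists l : 'I_(q %/ h), exists2 k, k < h & U =1 shift (k * m) (T l)].
Proof.
case: hS => [[[[m_gt0 S_per] _] S_win] S_neg] h.
pose w := weight m S.
pose T (l : 'I_(q %/ h)) i : 'Z_q := (partial_sum S i + l%:R)%R.
have h_gt0 : 0 < h := additive_order_gt0 w.
have DT l : D (T l) =1 S by apply: D_partial_sum.
have T_shift l i k : T l (i + k * m) = (T l i + w *+ k)%R.
  by rewrite /T partial_sum_addM_period // addrAC.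
have T_per l i : T l (i + h * m) = T l i.
  by rewrite T_shift mulrn_additive_order addr0.
have T_win l l' i j : window n.+1 (T l) i = window n.+1 (T l') j ->
    l = l' /\ i = j %[mod h * m].
  move=> eq_win; have := window_D eq_win.
  rewrite (eq_window _ _ (DT l)) (eq_window _ _ (DT l')) => /S_win eq_ij.
  (* The differences fix [i] and [j] only modulo [m]. The first entries settle the rest: the common
     remainder contributes the same partial sum, which cancels and leaves an equation between
     [l%:R + w *+ (i %/ m)] and its analogue for [l'] and [j]. *)
  move/eq_windowP/(_ 0 isT): eq_win; rewrite !addn0.
  rewrite (divn_eq i m) (divn_eq j m) ![_ * m + _]addnC !T_shift eq_ij /T.
  rewrite -!addrA => /addrI /(coset_repr_inj hq (ltn_ord l) (ltn_ord l')).
  case=> [eq_l eq_k]; split; first exact: val_inj.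
  by apply/eqP; rewrite eqn_modDl -!muln_modl eq_k.
have T_rev l l' i j : window n.+1 (T l) i <> rev (window n.+1 (T l') j).
  move/rev_window_D.
  by rewrite (eq_window _ _ (DT l)) (eq_window _ _ (DT l')); apply: S_neg.
exists T; split.
- move=> l; split; last exact: T_rev.
  split; last by move=> i j /T_win[].
  split=> [|p [p_gt0 p_per]]; first by split; rewrite ?muln_gt0 ?h_gt0.
  (* If [p] is a period, the windows at [p] and [0] agree, so [h * m] divides [p]. *)
  apply: dvdn_leq => //; apply/eqP; rewrite -(mod0n (h * m)).
  suff /T_win[_] : window n.+1 (T l) p = window n.+1 (T l) 0 by [].
  by apply/eq_windowP => k _; rewrite addnC p_per.
- move=> l l' neq_ll'; exists (l'%:R - l%:R)%R.
    rewrite subr_eq0; apply: contra neq_ll' => /eqP eq_l.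
    (* Both indices are below [q %/ h <= q], so they stay distinct in ['Z_q]. *)
    rewrite eq_sym; apply/eqP/val_inj/(eq_Zp_nat_small hq _ _ eq_l);
      exact: leq_trans (ltn_ord _) (leq_div _ _).
  by move=> i; rewrite /T -addrA [(l%:R + _)%R]addrC subrK.
- move=> l l' neq_ll'; split=> i j; last exact: T_rev.
  by case/T_win => eq_l; rewrite eq_l eqxx in neq_ll'.
- move=> U; split=> [[_ DU] | [l [k _ UE]]].
    (* A preimage of [S] is determined by its value at 0, so decomposing [U 0] yields both the index
       [l] and the shift [k]. *)
    have [l [k lt_kh U0]] := coset_repr_surj w hq (U 0).
    exists l, k => // i.
    by rewrite /shift T_shift (eq_partial_sum_of_D DU) U0 addrA.
  split; last first.
    move=> i; rewrite -(DT l i) /D !UE /shift !T_shift.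
    by rewrite opprD addrACA subrr addr0.
  exists (h * m); split; first by rewrite muln_gt0 h_gt0.
  by move=> i; rewrite !UE /shift addnAC T_per.
Qed.
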